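(* Let $\Gamma$ be a finitely generated group. If one of the following properties holds, then $\Gamma$ has the Liouville property. 1. $\Gamma$ admits an affine isometric action on a real Hilbert space with vanishing Poincaré exponent. 2. $\Gamma$ admits an affine isometric action on a real Hilbert space that has almost fixed points and has a finite Poincaré exponent. 3. $\Gamma$ admits an affine isometric action $\alpha : \Gamma \curvearrowright H$ on a real Hilbert space such that $\|\alpha_g(0)\| \succ |g|^{1/2}$, i.e. $\|\alpha_g(0)\|/|g|^{1/2} \to +\infty$ as $|g| \to +\infty$, where $|\cdot|$ is a word length function on $\Gamma$.
   Context: A probability measure $\mu$ on $\Gamma$ is adapted if it is finitely supported, symmetric, and its support generates $\Gamma$. $\Gamma$ is $\mu$-Liouville if every bounded $\mu$-harmonic function on $\Gamma$ is constant; $\Gamma$ has the Liouville property if it is $\mu$-Liouville for every adapted $\mu$. The Poincaré exponent of an affine isometric action $\alpha:\Gamma\curvearrowright H$ is $\delta(\alpha)=\limsup_{s\to+\infty}\frac1s\log|\{g\in\Gamma:\|\alpha_g(0)\|^2\le s\}|\in[0,+\infty]$. The action $\alpha$ has almost fixed points if for every finite $F\subset\Gamma$ and $\varepsilon>0$ there is $x\in H$ with $\|\alpha_g(x)-x\|\le\varepsilon$ for all $g\in F$. *)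

(* Defs.v *)
From HB Require Import structures.
From mathcomp Require Import all_boot all_order all_algebra.
From mathcomp Require Import sesquilinear.
From mathcomp Require Import all_classical all_reals all_analysis.

Set Implicit Arguments.
Unset Strict Implicit.
Unset Printing Implicit Defensive.

Import Order.TTheory GRing.Theory Num.Theory.
Import numFieldNormedType.Exports.

Local Open Scope classical_set_scope.
Local Open Scope ring_scope.

HB.mixin Record isHilbert (R : realType) H of CompleteNormedModule R H := {
  inner : {dot H for (@idfun R)};
  inner_norm : forall x : H, inner x x = `|x| ^+ 2
}.

#[short(type="hilbertType")]
HB.structure Definition Hilbert (R : realType) :=
  {H of isHilbert R H & CompleteNormedModule R H}.

Section Groups.
Variable G : groupType.
Implicit Types (S : set G) (l : G -> nat).

Definition generates S :=
  smallest (fun A : set G => group_closed (mem A)) S = [set: G].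

Definition finitely_generated := exists2 S, finite_set S & generates S.

(* Products of exactly [n] factors from [S] and its inverses. *)
Definition words S (n : nat) : set G :=
  [set (\prod_(s <- w) s)%g | w in
    [set w : seq G | size w = n /\ forall s, s \in w -> S s \/ S (s^-1)%g]].

Definition word_length_function l :=
  exists S, [/\ finite_set S, generates S &
    forall g, words S (l g) g /\ forall n, words S n g -> (l g <= n)%N].

End Groups.

Section Liouville.
Variables (R : realType) (G : groupType).

(* A finitely supported probability measure on the discrete group [G] is
   represented by its mass function [g |-> mu {g}]. *)
Record adapted (mu : G -> R) : Prop := Adapted {
  adapted_ge0 : forall g, 0 <= mu g;
  adapted_finite : finite_set [set g | mu g != 0];
  adapted_sum1 : \sum_(g \in [set: G]) mu g = 1;
  adapted_sym : forall g, mu (g^-1)%g = mu g;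
  adapted_gen : generates [set g | mu g != 0]
}.

Definition mu_harmonic (mu f : G -> R) :=
  forall g, f g = \sum_(s \in [set: G]) mu s * f (g * s)%g.

Definition mu_liouville (mu : G -> R) :=
  forall f : G -> R, mu_harmonic mu f -> bounded_fun f -> exists c, f = cst c.

Definition liouville := forall mu : G -> R, adapted mu -> mu_liouville mu.

End Liouville.
Arguments liouville : clear implicits.

Section AffineIsometricActions.
Variables (R : realType) (G : groupType) (H : hilbertType R).
Variable alpha : G -> H -> H.

Record affine_isometric_action : Prop := AffineIsometricAction {
  aia1 : forall x, alpha 1%g x = x;
  aiaM : forall g h x, alpha (g * h)%g x = alpha g (alpha h x);
  aia_affine : forall g, exists2 p : {linear H -> H},
    (forall x, `|p x| = `|x|) & (forall x, alpha g x = p x + alpha g 0)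
}.

(* An infinite ball contributes +oo, as [counting] is +oo on infinite sets and
   [lne +oo = +oo]. *)
Definition poincare_exponent : \bar R :=
  limf_esup (fun s : R => (s^-1%:E *
    lne (counting [set g : G | (`|alpha g 0| ^+ 2 <= s)%R]))%E) +oo%R.

Definition almost_fixed_points :=
  forall (F : set G) (e : R), finite_set F -> 0 < e ->
    exists x : H, forall g, F g -> `|alpha g x - x| <= e.

(* The quotient tends to +oo as [l g] does; it is 0 when [l g = 0], which is
   excluded as soon as [0 < N]. *)
Definition dominates_sqrt (l : G -> nat) :=
  forall M : R, exists N : nat, forall g, (N <= l g)%N ->
    M <= `|alpha g 0| / Num.sqrt (l g)%:R.

End AffineIsometricActions.

(* Main.v *)
(* Let [b g = alpha g x - x], let [X] be the random walk with step distribution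
   [mu] and [H n] the entropy of [X n]. If [f] is a bounded harmonic function,
   the increment [H n.+1 - H n] is an average of relative entropies of the laws
   of [s * X n] with respect to the law of [X n.+1], and [f] separates these
   laws unless [f s = f 1]; so [H n >= d * n] with [d > 0] unless [f] is
   constant. On the other hand, if [Z] bounds the sums of [exp (- t |b g|^2)],
   Gibbs' inequality gives [H n <= t * E |b (X n)|^2 + ln Z], where
   [E |b (X n)|^2 <= n * E |b (X 1)|^2] when [n] is a power of 2. Hence [mu] is
   Liouville as soon as [t * E |b (X 1)|^2] can be made arbitrarily small: by
   letting [t] tend to 0 (cases 1 and 3), or by choosing [x] almost fixed
   (case 2). *)

Require Import Defs.
From mathcomp Require Import all_boot all_order all_algebra.
From mathcomp Require Import finmap ring lra sesquilinear.
From mathcomp Require Import all_classical all_reals all_analysis.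

Set Implicit Arguments.
Unset Strict Implicit.
Unset Printing Implicit Defensive.

Import Order.TTheory GRing.Theory Num.Theory.
Import numFieldNormedType.Exports.

Local Open Scope classical_set_scope.
Local Open Scope ring_scope.

(** * Elementary inequalities for [ln], [expR] and finite sums *)

Section Inequalities.
Variable R : realType.
Implicit Types x : R.

Lemma ln_le_subr1 x : 0 < x -> ln x <= x - 1.
Proof.
move=> x0; have := @le_ln1Dx R (x - 1).
by rewrite [1 + _]addrC subrK; apply; rewrite ltrBrDl subrr.
Qed.

(** Since [1 - x <= expR (- x)], [expR x] is at most the inverse of [1 - x]; compare with [(1 + x +
    2 x^2) (1 - x) = 1 + x^2 (1 - 2 x)]. *)
Lemma expR_le_quadratic x : `|x| <= 2^-1 -> expR x <= 1 + x + 2 * x ^+ 2.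
Proof.
rewrite ler_norml => /andP[x1 x2].
have x3 : 0 < 1 - x by lra.
have : (expR x)^-1 >= 1 - x by rewrite -expRN; exact: expR_ge1Dx.
rewrite -lef_pV2 ?posrE ?invr_gt0 ?expR_gt0// invrK => /le_trans; apply.
rewrite -div1r ler_pdivrMr//.
have : 0 <= x ^+ 2 * (1 - 2 * x) by rewrite mulr_ge0 ?sqr_ge0//; lra.
nra.
Qed.

Lemma ler_sum_subseq (T : eqType) (A B : seq T) (F : T -> R) :
  uniq A -> uniq B -> {subset A <= B} -> (forall y, 0 <= F y) ->
  \sum_(y <- A) F y <= \sum_(y <- B) F y.
Proof.
move=> uA uB AB F0.
rewrite (perm_big [seq y <- B | y \in A]); last first.
  apply: uniq_perm => //; first exact: filter_uniq.
  by move=> y; rewrite mem_filter andb_idr//; exact: AB.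
by rewrite big_filter [leRHS](bigID (mem A))/= lerDl sumr_ge0.
Qed.

End Inequalities.

(** * Expectations, masses and entropy of the random walk *)

Section RandomWalk.
Variables (R : realType) (G : groupType) (S : seq G) (mu : G -> R).
Hypothesis mu_gt0 : {in S, forall s, 0 < mu s}.
Hypothesis mu_sum1 : \sum_(s <- S) mu s = 1.
Implicit Types (phi psi f : G -> R) (n : nat) (g h s x : G).

Definition average phi g := \sum_(s <- S) mu s * phi (g * s)%g.

(* [walk n phi] is the expectation of [phi (X n)], where [X] is the random walk
   with step distribution [mu] started at [1]. *)
Definition walk n phi := iter n average phi 1%g.

Lemma iter_average_transl n phi h g :
  iter n average phi (h * g)%g = iter n average (fun x => phi (h * x)%g) g.
Proof.
elim: n g => //= n IH g; apply: eq_bigr => s _.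
by rewrite -IH mulgA.
Qed.

Lemma iter_averageE n phi g :
  iter n average phi g = walk n (fun x => phi (g * x)%g).
Proof. by rewrite -[g in LHS]mulg1 iter_average_transl. Qed.

Lemma walk0 phi : walk 0 phi = phi 1%g. Proof. by []. Qed.

(** Conditioning on the first step; [walkSr] conditions on the last one. *)
Lemma walkS n phi :
  walk n.+1 phi = \sum_(s <- S) mu s * walk n (fun x => phi (s * x)%g).
Proof.
rewrite /walk iterS /average; apply: eq_bigr => s _.
by rewrite mul1g iter_averageE.
Qed.

Lemma walkSr n phi : walk n.+1 phi = walk n (average phi).
Proof. by rewrite /walk iterSr. Qed.

Lemma walkD m n phi :
  walk (m + n) phi = walk m (fun g => walk n (fun h => phi (g * h)%g)).
Proof.
rewrite /walk iterD; congr (iter m average _ 1%g).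
by apply/funext => g; rewrite iter_averageE.
Qed.

Lemma walk_linear n (c : R) phi psi :
  walk n (fun x => c * phi x + psi x) = c * walk n phi + walk n psi.
Proof.
elim: n phi psi => // n IH phi psi; rewrite !walkS mulr_sumr -big_split/=.
by apply: eq_bigr => s _; rewrite IH; ring.
Qed.

Lemma walk_cst n (c : R) : walk n (cst c) = c.
Proof.
elim: n => // n IH; rewrite walkS.
under eq_bigr do rewrite [walk _ _]IH.
by rewrite -mulr_suml mu_sum1 mul1r.
Qed.

Lemma walkDl n phi psi :
  walk n (fun x => phi x + psi x) = walk n phi + walk n psi.
Proof.
rewrite -[walk n phi]mul1r -walk_linear; congr walk.
by apply/funext => x; rewrite mul1r.
Qed.

Lemma walkZ n (c : R) phi : walk n (fun x => c * phi x) = c * walk n phi.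
Proof.
rewrite -[RHS]addr0 -[0 in RHS](walk_cst n) -walk_linear; congr walk.
by apply/funext => x; rewrite /= addr0.
Qed.

Lemma walk_sum n (I : Type) (r : seq I) (F : I -> G -> R) :
  walk n (fun x => \sum_(i <- r) F i x) = \sum_(i <- r) walk n (F i).
Proof.
elim: r => [|i r IH].
  rewrite big_nil -[RHS](walk_cst n); congr walk.
  by apply/funext => x; rewrite big_nil.
rewrite big_cons -IH -walkDl; congr walk.
by apply/funext => x; rewrite big_cons.
Qed.

(** The support of [X n], listed without repetition: expectations become finite sums over it, and
    the logarithms of masses are only taken there. *)
Definition reach n : seq G :=
  iter n (fun T => undup [seq (s * x)%g | s <- S, x <- T]) [:: 1%g].

Lemma reach_uniq n : uniq (reach n).
Proof. by case: n => //= n; exact: undup_uniq. Qed.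

Lemma reachS n s x : s \in S -> x \in reach n -> (s * x)%g \in reach n.+1.
Proof. by move=> sS xn; rewrite mem_undup; apply/allpairsP; exists (s, x). Qed.

Lemma walk_le n phi psi : {in reach n, forall x, phi x <= psi x} ->
  walk n phi <= walk n psi.
Proof.
elim: n phi psi => [|n IH] phi psi le; first by rewrite le ?mem_head.
rewrite !walkS big_seq [leRHS]big_seq; apply: ler_sum => s sS.
rewrite ler_wpM2l ?(ltW (mu_gt0 sS))//; apply: IH => x xn.
exact/le/reachS.
Qed.

Lemma walk_ge0 n phi : (forall x, 0 <= phi x) -> 0 <= walk n phi.
Proof.
by move=> phi0; rewrite -[0](walk_cst n) walk_le// => x _; exact: phi0.
Qed.

Definition mass n x : R := walk n (fun y => (y == x)%:R).

Lemma walkE n phi : walk n phi = \sum_(x <- reach n) mass n x * phi x.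
Proof.
transitivity (walk n (fun y => \sum_(x <- reach n) phi x * (y == x)%:R)).
  apply/eqP; rewrite eq_le; apply/andP; split; apply: walk_le => y yn;
  rewrite (bigD1_seq y) ?reach_uniq//= eqxx mulr1 big1 ?addr0// => x /negPf;
  by rewrite eq_sym => ->; rewrite mulr0.
by rewrite walk_sum; apply: eq_bigr => x _; rewrite walkZ mulrC.
Qed.

(** Among the paths to [s * y], keep only those whose first step is [s]. *)
Lemma massS_ge n s y : s \in S -> mu s * mass n y <= mass n.+1 (s * y)%g.
Proof.
move=> sS; rewrite /mass walkS (big_rem s)//=.
have -> : (fun x => ((s * x)%g == (s * y)%g)%:R) = (fun x => (x == y)%:R : R).
  by apply/funext => x; rewrite (inj_eq (mulgI s)).
rewrite lerDl big_seq sumr_ge0// => t /mem_rem tS.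
by rewrite mulr_ge0 ?(ltW (mu_gt0 tS))// walk_ge0.
Qed.

Lemma mass_gt0 n x : x \in reach n -> 0 < mass n x.
Proof.
elim: n x => [|n IH] x; first by rewrite inE /mass walk0 eq_sym => ->.
rewrite mem_undup => /allpairsP[[s y] /= [sS yn ->]].
by rewrite (lt_le_trans _ (massS_ge _ _ sS))// mulr_gt0 ?mu_gt0 ?IH.
Qed.

Definition walk_entropy n := walk n (fun x => - ln (mass n x)).

(* Gibbs' inequality against the subprobability [expR (- w x) / Z]. *)
Lemma walk_entropy_le n (w : G -> R) (Z : R) : 0 < Z ->
  (forall T : seq G, uniq T -> \sum_(x <- T) expR (- w x) <= Z) ->
  walk_entropy n <= walk n w + ln Z.
Proof.
move=> Z0 hZ.
(* [r] is the density of the subprobability with respect to the law of [X n]: use [ln r <= r - 1],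
   the mean of [r] being at most 1. *)
pose r x := expR (- w x) / (Z * mass n x).
have : walk_entropy n <= walk n (fun x => w x + (ln Z - 1 + r x)).
  apply: walk_le => x xn; have m0 := mass_gt0 xn.
  have r0 : 0 < r x by rewrite divr_gt0 ?expR_gt0 ?mulr_gt0.
  have := ln_le_subr1 r0.
  rewrite ln_div ?posrE ?expR_gt0 ?mulr_gt0// expRK lnM ?posrE//; lra.
move=> /le_trans; apply; rewrite walkDl walkDl walk_cst lerD2l.
suff : walk n r <= 1 by lra.
rewrite walkE.
rewrite big_seq (eq_bigr (fun x => expR (- w x) / Z)) => [|x xn]; last first.
  have m0 := mass_gt0 xn; rewrite /r /=; field.
  by rewrite !gt_eqF.
by rewrite -big_seq -mulr_suml ler_pdivrMr// mul1r hZ ?reach_uniq.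
Qed.

Lemma walk_harmonic f n : average f =1 f -> walk n f = f 1%g.
Proof. by move=> /funext hf; elim: n => // n IH; rewrite walkSr hf. Qed.

Lemma walk_transl_harmonic f n g : average f =1 f ->
  walk n (fun x => f (g * x)%g) = f g.
Proof.
move=> /funext hf; rewrite -iter_averageE.
by have -> : iter n average f = f by elim: n => //= n ->.
Qed.

(* The increment of the entropy is the average over [s] of the relative entropy
   of the law of [s * X n] with respect to that of [X n.+1]. Each of these is
   bounded below by testing against [f s / 4 * f], as in the Donsker-Varadhan
   variational formula. *)
Lemma walk_entropyS_ge f n :
  average f =1 f -> f 1%g = 0 -> (forall g, `|f g| <= 1) ->
  walk_entropy n + \sum_(s <- S) mu s * (f s ^+ 2 / 8) <= walk_entropy n.+1.
Proof.
move=> hf f1 fb.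
(* Both sides become averages over the first step, so one [s] at a time suffices. *)
have -> : walk_entropy n = \sum_(s <- S) mu s * walk_entropy n.
  by rewrite -mulr_suml mu_sum1 mul1r.
rewrite [leRHS]walkS -big_split/= big_seq [leRHS]big_seq.
apply: ler_sum => s sS; rewrite -mulrDr ler_wpM2l ?(ltW (mu_gt0 sS))//.
(* This [c] maximizes [c * f s - 2 * c ^+ 2], with value [f s ^+ 2 / 8]. *)
pose c := f s / 4.
(* The law of [X n.+1], tilted by [expR (c * f)], relative to the law of [s * X n]. *)
pose r x := mass n.+1 (s * x)%g * expR (c * f (s * x)%g) / mass n x.
have : walk n (fun x => - ln (mass n x) + (c * f (s * x)%g + (1 - r x))) <=
       walk n (fun x => - ln (mass n.+1 (s * x)%g)).
  apply: walk_le => x xn; have m0 := mass_gt0 xn.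
  have m1 := mass_gt0 (reachS sS xn).
  have r0 : 0 < r x by rewrite divr_gt0 ?mulr_gt0 ?expR_gt0.
  have := ln_le_subr1 r0.
  rewrite ln_div ?posrE ?mulr_gt0 ?expR_gt0// lnM ?posrE ?expR_gt0// expRK; lra.
apply: le_trans; rewrite !walkDl -/(walk_entropy n) lerD2l walkZ.
rewrite walk_transl_harmonic// walk_cst.
suff : walk n r <= 1 + 2 * c ^+ 2.
  have -> : walk n (fun x => - r x) = - walk n r.
    by rewrite -mulN1r -walkZ; congr walk; apply/funext => x; rewrite mulN1r.
  have -> : f s ^+ 2 / 8 = c * f s - 2 * c ^+ 2 by rewrite /c; field.
  lra.
have cb g : `|c * f g| <= 4^-1.
  rewrite -[leRHS]mulr1 normrM ler_pM// /c normrM (@ger0_norm _ 4^-1)//.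
  by rewrite ler_piMl.
(* The linear term of the exponential has mean [c * f 1 = 0]. *)
have : walk n.+1 (fun x => expR (c * f x)) <= 1 + 2 * c ^+ 2.
  have : walk n.+1 (fun x => expR (c * f x)) <=
         walk n.+1 (fun x => c * f x + (1 + 2 * c ^+ 2)).
    apply: walk_le => x _.
    have := @expR_le_quadratic R (c * f x).
    move=> /(_ (le_trans (cb x) _)) => /(_ ltac:(lra)) /le_trans; apply.
    rewrite [1 + _]addrC -addrA lerD2l lerD2l exprMn ler_wpM2l//.
    rewrite ler_piMr ?sqr_ge0//.
    by have := fb x; rewrite ler_norml => /andP[]; nra.
  move=> /le_trans; apply.
  by rewrite walkDl walk_cst walkZ walk_harmonic// f1 mulr0 add0r.
(* The denominators of [r] cancel, leaving the sum of [F] over the translate of [reach n] by [s],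
   which is contained in [reach n.+1]. *)
apply: le_trans; rewrite !walkE.
pose F y := mass n.+1 y * expR (c * f y).
rewrite [leLHS]big_seq (eq_bigr (fun x => F (s * x)%g)); last first.
  by move=> x xn; rewrite mulrC divfK// gt_eqF// mass_gt0.
rewrite -big_seq -(big_map (fun x => s * x)%g xpredT F).
apply: ler_sum_subseq.
- by rewrite map_inj_uniq ?reach_uniq//; exact: mulgI.
- exact: reach_uniq.
- by move=> _ /mapP[x xn ->]; exact: reachS.
- by move=> x; rewrite mulr_ge0 ?expR_ge0// walk_ge0.
Qed.

Hypothesis mu_sym : forall F : G -> R,
  \sum_(s <- S) mu s * F (s^-1)%g = \sum_(s <- S) mu s * F s.

(** Inversion reverses the order of the steps and inverts each; by symmetry the law of [X n] is
    unchanged. In the induction, the first step is traded for the last. *)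
Lemma walkV n phi : walk n (fun x => phi (x^-1)%g) = walk n phi.
Proof.
elim: n phi => [|n IH] phi; first by rewrite !walk0 invg1.
rewrite walkS [RHS]walkSr -[RHS]IH.
transitivity (\sum_(s <- S) mu s * walk n (fun x => phi (x^-1 * s^-1)%g)).
  apply: eq_bigr => s _; congr (_ * walk _ _).
  by apply/funext => x; rewrite invgM.
rewrite (mu_sym (fun s => walk n (fun x => phi (x^-1 * s)%g))).
by rewrite /average walk_sum; apply: eq_bigr => s _; rewrite walkZ.
Qed.

End RandomWalk.

(** * Sublinear entropy kills harmonic functions *)

Section SublinearEntropy.
Variables (R : realType) (G : groupType) (S : seq G) (mu : G -> R).
Hypothesis mu_gt0 : {in S, forall s, 0 < mu s}.
Hypothesis mu_sum1 : \sum_(s <- S) mu s = 1.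

(** The upper bound is assumed only at powers of 2, where iterated doubling of the mean squared
    displacement will supply it. *)
Lemma harmonic_eq0 (f : G -> R) :
  (forall c, 0 < c -> exists C, forall k,
    walk_entropy S mu (2 ^ k) <= c * 2 ^+ k + C) ->
  average S mu f =1 f -> f 1%g = 0 -> (forall g, `|f g| <= 1) ->
  {in S, forall s, f s = 0}.
Proof.
move=> hH hf f1 fb s sS; apply/eqP; rewrite -sqrf_eq0 eq_le sqr_ge0 andbT.
set d := \sum_(s <- S) mu s * (f s ^+ 2 / 8).
have Hd n : n%:R * d <= walk_entropy S mu n.
  elim: n => [|n IH].
    by rewrite mul0r /walk_entropy walk0 /mass walk0 eqxx ln1 oppr0.
  apply: le_trans (walk_entropyS_ge mu_gt0 mu_sum1 n hf f1 fb).
  by rewrite mulrSr mulrDl mul1r lerD2r.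
have sd : mu s * (f s ^+ 2 / 8) <= d.
  rewrite /d (big_rem s)//= lerDl big_seq sumr_ge0// => t /mem_rem tS.
  by rewrite mulr_ge0 ?(ltW (mu_gt0 tS))// divr_ge0 ?sqr_ge0.
suff d0 : d <= 0.
  have := le_trans sd d0; rewrite pmulr_rle0 ?mu_gt0//; lra.
rewrite leNgt; apply/negP => d0.
(* Slope [d / 2] leaves [2 ^+ k * (d / 2) <= C] for all [k], which fails for large [k] because
   [k < 2 ^ k]. *)
have [C hC] := hH (d / 2) ltac:(lra).
have kC k : 2 ^+ k * (d / 2) <= C.
  have := le_trans (Hd (2 ^ k)%N) (hC k); rewrite natrX; lra.
have := kC (Num.bound (C / (d / 2))); apply/negP; rewrite -ltNge.
rewrite -ltr_pdivrMr; last lra.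
have C0 : 0 <= C by apply: le_trans (kC 0%N); rewrite expr0 mul1r; lra.
apply: (lt_trans (archi_boundP _)); first by rewrite divr_ge0//; lra.
by rewrite -natrX ltr_nat ltn_expl.
Qed.

End SublinearEntropy.

(** * Squared displacement of a point along the walk *)

Section Displacement.
Variables (R : realType) (G : groupType) (H : hilbertType R).
Variable alpha : G -> H -> H.
Hypothesis aia : affine_isometric_action alpha.
Implicit Types (x u v : H) (g h : G).

Lemma inner_sum_sum (I : Type) (r : seq I) (c : I -> R) (F : I -> H) :
  inner (\sum_(i <- r) c i *: F i) (\sum_(i <- r) c i *: F i) =
  \sum_(i <- r) c i * \sum_(j <- r) c j * inner (F i) (F j).
Proof.
rewrite linear_sumlz; apply: eq_bigr => i _; rewrite linearZl_LR; congr (_ * _).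
by rewrite linear_sumr; apply: eq_bigr => j _; rewrite linearZr_LR.
Qed.

Lemma sqr_norm_sub u v :
  `|u - v| ^+ 2 = `|u| ^+ 2 + `|v| ^+ 2 - 2 * inner u v.
Proof.
have innerC : inner v u = inner u v.
  by have := hermC (inner (R := R)) v u; rewrite expr0 mul1r.
rewrite -!inner_norm linearBl !linearBr /= innerC; ring.
Qed.

Lemma affine_isometry g u v : `|alpha g u - alpha g v| = `|u - v|.
Proof.
have [p pN pE] := aia_affine aia g.
by rewrite (pE u) (pE v) opprD addrACA subrr addr0 -raddfB pN.
Qed.

Definition displacement x g := `|alpha g x - x| ^+ 2.

Lemma displacement_mulVg x g h :
  displacement x (g^-1 * h)%g = `|alpha h x - alpha g x| ^+ 2.
Proof.
rewrite /displacement -[X in `|_ - X|](aia1 aia x) -(mulVg g) !(aiaM aia).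
by rewrite affine_isometry.
Qed.

(** Change of base point: summability is known at 0, whereas the drift may be small only at another
    [x]. The constants come from [(a + 2 b)^2 + (a - 2 b)^2 = 2 a^2 + 8 b^2]. *)
Lemma displacement0_le x g :
  displacement 0 g <= 2 * displacement x g + 8 * `|x| ^+ 2.
Proof.
rewrite /displacement subr0.
have : `|alpha g 0| <= `|alpha g x - x| + 2 * `|x|.
  have := affine_isometry g 0 x; rewrite sub0r normrN => nx.
  have -> : alpha g 0 = (alpha g x - x) + (alpha g 0 - alpha g x + x).
    by rewrite [_ + x in RHS]addrC addrA subrK addrC subrK.
  apply: (le_trans (ler_normD _ _)); rewrite lerD2l.
  apply: (le_trans (ler_normD _ _)); rewrite nx; lra.
have := normr_ge0 (alpha g 0); have := normr_ge0 x.
have := normr_ge0 (alpha g x - x).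
set a := `|_ - _|; set b := `|x|; set c := `|_| => a0 b0 c0 cab.
have : c ^+ 2 <= (a + 2 * b) ^+ 2 by rewrite lerXn2r// nnegrE; lra.
have := sqr_ge0 (a - 2 * b); nra.
Qed.

Variables (S : seq G) (mu : G -> R).
Hypothesis mu_gt0 : {in S, forall s, 0 < mu s}.
Hypothesis mu_sum1 : \sum_(s <- S) mu s = 1.
Hypothesis mu_sym : forall F : G -> R,
  \sum_(s <- S) mu s * F (s^-1)%g = \sum_(s <- S) mu s * F s.

(* [X (n + n)] is distributed as [Y^-1 * Z], with [Y] and [Z] independent copies
   of [X n]; and [E |b Y - b Z|^2 = 2 E |b Y|^2 - 2 |E (b Y)|^2]. *)
Lemma walk_displacement_double x n :
  walk S mu (n + n) (displacement x) <= 2 * walk S mu n (displacement x).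
Proof.
rewrite walkD -(walkV mu_sum1 mu_sym).
pose b g := alpha g x - x.
have -> : (fun g => walk S mu n (fun h => displacement x (g^-1 * h)%g)) =
    (fun g => -2 * walk S mu n (fun h => inner (b g) (b h))
              + (displacement x g + walk S mu n (displacement x))).
  apply/funext => g.
  rewrite -walkZ// -[displacement x g](walk_cst mu_sum1 n) -!walkDl//.
  congr walk; apply/funext => h; rewrite displacement_mulVg /=.
  have -> : alpha h x - alpha g x = b h - b g.
    by rewrite /b opprB addrA subrK.
  rewrite -normrN opprB sqr_norm_sub /displacement -/(b g) -/(b h); ring.
rewrite walk_linear walkDl walk_cst//.
suff : 0 <= walk S mu n (fun g => walk S mu n (fun h => inner (b g) (b h))).
  lra.
rewrite walkE//; under eq_bigr do rewrite walkE//.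
by rewrite -inner_sum_sum inner_norm sqr_ge0.
Qed.

Lemma walk_displacement_pow2 x k :
  walk S mu (2 ^ k) (displacement x)
    <= 2 ^+ k * \sum_(s <- S) mu s * displacement x s.
Proof.
elim: k => [|k IH].
  rewrite expr0 mul1r expn0 walkS le_eqVlt; apply/orP; left; apply/eqP.
  by apply: eq_bigr => s _; rewrite walk0 mulg1.
rewrite expnS mul2n -addnn exprS -mulrA.
by rewrite (le_trans (walk_displacement_double _ _))// ler_pM2l.
Qed.

End Displacement.

(** * Summability of Gaussian weights from growth bounds *)

Section Summability.
Variable R : realType.

Lemma sum_levels_le (T : eqType) (lev : T -> nat) (w : T -> R) (C q : R) :
  0 <= C -> 0 <= q < 1 ->
  (forall A k, uniq A -> \sum_(y <- A | lev y == k) w y <= C * q ^+ k) ->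
  forall A, uniq A -> \sum_(y <- A) w y <= C / (1 - q).
Proof.
move=> C0 /andP[q0 q1] hA A uA.
pose K := (\max_(y <- A) lev y).+1.
have -> : \sum_(y <- A) w y = \sum_(0 <= k < K) \sum_(y <- A | lev y == k) w y.
  under [RHS]eq_bigr do rewrite big_mkcond/=.
  rewrite exchange_big/= big_seq [RHS]big_seq; apply: eq_bigr => y yA.
  rewrite -big_mkcond/= (eq_bigl (fun k => k == lev y)); last first.
    by move=> k; rewrite eq_sym.
  by rewrite (big_nat1_eq _ (fun=> w y)) ltnS leq_bigmax_seq.
apply: (@le_trans _ _ (\sum_(0 <= k < K) C * q ^+ k)).
  by apply: ler_sum => k _; exact: hA.
rewrite -mulr_sumr ler_wpM2l// -[leRHS]mul1r ler_pdivlMr ?subr_gt0//.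
have := subrX1 q K; rewrite -(big_mkord xpredT (fun i => q ^+ i)) => e.
have : 0 <= q ^+ K by rewrite exprn_ge0.
nra.
Qed.

Definition uniformly_summable (T : eqType) (w : T -> R) :=
  exists2 Z, 0 < Z & forall A, uniq A -> \sum_(y <- A) w y <= Z.

(** Level [k] contributes at most [B * (K * r) ^+ k], the term of a convergent geometric series. *)
Lemma uniformly_summable_levels (T : eqType) (lev : T -> nat) (w : T -> R)
    (B K r : R) :
  0 < B -> 0 < K -> 0 <= r -> K * r < 1 ->
  (forall A k, uniq A -> {in A, forall y, lev y = k} ->
    (size A)%:R <= B * K ^+ k) ->
  (forall y, w y <= r ^+ lev y) ->
  uniformly_summable w.
Proof.
move=> B0 K0 r0 Kr hA hw; exists (B / (1 - K * r)).
  by rewrite divr_gt0 ?subr_gt0.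
apply: (sum_levels_le (lev := lev)) => [||A k uA]; first exact: ltW.
  by rewrite Kr mulr_ge0// ltW.
rewrite -big_filter; set A' := [seq y <- A | _].
have A'k : {in A', forall y, lev y = k}.
  by move=> y; rewrite mem_filter => /andP[/eqP].
apply: (@le_trans _ _ (\sum_(y <- A') r ^+ k)).
  by rewrite big_seq [leRHS]big_seq; apply: ler_sum => y yA; rewrite -(A'k _ yA).
rewrite big_const_seq count_predT iter_addr_0 -mulr_natl exprMn mulrA.
by rewrite ler_wpM2r ?exprn_ge0// hA// filter_uniq.
Qed.

Lemma uniformly_summable_scale (T : eqType) (w : T -> R) (c : R) : 0 < c ->
  uniformly_summable (fun y => c * w y) -> uniformly_summable w.
Proof.
move=> c0 [Z Z0 hZ]; exists (Z / c); first exact: divr_gt0.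
by move=> A uA; rewrite ler_pdivlMr// mulrC mulr_sumr hZ.
Qed.

Lemma size_le_counting (T : choiceType) (A : set T) (s : seq T) (r : R) :
  uniq s -> [set` s] `<=` A -> (lne (counting A) <= r%:E)%E ->
  (size s)%:R <= expR r.
Proof.
move=> us sA; rewrite /counting; case: asboolP => [fA|_]; last by rewrite leye_eq.
have ss : (size s <= #|` fset_set A|)%N.
  by apply: uniq_leq_size => // y ys; rewrite in_fset_set// inE; exact: sA.
(* For empty [A], [lne] gives [-oo] and the bound says nothing, but then [s] is empty. *)
have [N0|N0] := posnP #|` fset_set A|.
  by move: ss; rewrite N0 leqn0 => /eqP ->; rewrite expR_ge0.
rewrite lne_EFin ?ltr0n// lee_fin -ler_expR lnK ?posrE ?ltr0n//.
by apply: le_trans; rewrite ler_nat.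
Qed.

Variables (G : groupType) (H : hilbertType R) (alpha : G -> H -> H).

Lemma poincare_exponent_lt (t : R) :
  (poincare_exponent alpha < t%:E)%E ->
  exists M : R, forall (s : R) (A : seq G), M < s -> 0 < s -> uniq A ->
    {in A, forall g, `|alpha g 0| ^+ 2 <= s} -> (size A)%:R <= expR (t * s).
Proof.
(* The upper limit is an infimum of suprema over neighbourhoods of [+oo]; one of these suprema is
   already below [t]. *)
move=> /ereal_inf_lt[_ [V [M [_ VM]] <-] supt]; exists M => s A Ms s0 uA As.
apply: (size_le_counting (A := [set g | `|alpha g 0| ^+ 2 <= s]) uA) => //.
have : (s^-1%:E * lne (counting [set g | (`|alpha g 0| ^+ 2 <= s)%R]) < t%:E)%E.
  by apply: le_lt_trans supt; apply: ereal_sup_ubound; exists s => //; exact: VM.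
by rewrite lte_pdivrMl// muleC -EFinM => /ltW.
Qed.

Lemma summable_of_poincare_exponent (t t' : R) : 0 <= t -> t < t' ->
  (poincare_exponent alpha < t%:E)%E ->
  uniformly_summable (fun g => expR (- (t' * displacement alpha 0 g))).
Proof.
move=> t0 tt' /poincare_exponent_lt[M hM].
pose lev g := Num.truncn (`|alpha g 0| ^+ 2).
have levE g : (lev g)%:R <= `|alpha g 0| ^+ 2 < (lev g).+1%:R.
  by rewrite truncn_itv ?sqr_ge0.
(* The growth bound holds only for radii above [M], so level [k] is counted inside the ball of
   squared radius [|M| + k + 1]. *)
apply: (@uniformly_summable_levels _ lev _ (expR (t * (`|M| + 1))) (expR t)
  (expR (- t'))) => //; rewrite ?expR_gt0 ?expR_ge0//.
- by rewrite -expRD expR_lt1 subr_lt0.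
- move=> A k uA Ak; rewrite -expRM_natl -expRD.
  have -> : t * (`|M| + 1) + k%:R * t = t * (`|M| + k.+1%:R).
    by rewrite -natr1; ring.
  have M0 := normr_ge0 M; have MM := ler_norm M.
  have k0 : 0 < k.+1%:R :> R by [].
  apply: hM => // [|g gA]; first lra.
  have /andP[_ /ltW] := levE g.
  by rewrite (Ak g gA) => /le_trans; apply; rewrite lerDr.
- move=> g; rewrite -expRM_natl ler_expR /displacement subr0 mulrN lerN2 mulrC.
  by have /andP[+ _] := levE g; apply: ler_wpM2l; lra.
Qed.

Lemma word_sphere_card (l : G -> nat) : word_length_function l ->
  exists2 K, (0 < K)%N & forall k (A : seq G), uniq A ->
    {in A, forall g, l g = k} -> (size A <= K ^ k)%N.
Proof.
move=> [S [/finite_seqP[r Sr] _ hl]].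
have [r' r'0 r'P] : exists2 r' : seq G,
    (0 < size r')%N & forall s, S s \/ S (s^-1)%g -> s \in r'.
  (* The added [1] makes the list nonempty. *)
  exists (1%g :: r ++ [seq (g^-1)%g | g <- r]) => // s.
  rewrite Sr inE mem_cat => -[/= ->|/= sr]; first by rewrite orbT.
  apply/orP; right; apply/orP; right; apply/mapP.
  by exists (s^-1)%g; rewrite ?invgK.
pose W k := iter k (fun T => [seq (s * y)%g | s <- r', y <- T]) [:: 1%g].
have W_size k : size (W k) = (size r' ^ k)%N.
  by elim: k => //= k IH; rewrite size_allpairs IH expnS.
exists (size r') => // k A uA Ak; rewrite -W_size; apply: uniq_leq_size => // g gA.
have [+ _] := hl g; rewrite (Ak g gA) => -[w [<- wS] <-] {k Ak}.
elim: w wS => [|s w IH] wS; first by rewrite big_nil mem_head.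
rewrite big_cons; apply/allpairsP; exists (s, \prod_(i <- w) i)%g; split => //=.
  exact/r'P/wS/mem_head.
by apply: IH => u uw; apply: wS; rewrite inE uw orbT.
Qed.

Lemma summable_of_dominates_sqrt (l : G -> nat) (t : R) : 0 < t ->
  word_length_function l -> dominates_sqrt alpha l ->
  uniformly_summable (fun g => expR (- (t * displacement alpha 0 g))).
Proof.
move=> t0 /word_sphere_card[K K0 hK] dom.
have K0' : 0 < K%:R :> R by rewrite ltr0n.
have lnK0 : 0 <= ln K%:R :> R by rewrite ln_ge0// ler1n.
(* Chosen so that [K * expR (- (t * a)) = expR (-1)]: decay at rate [t * a] beats the growth of word
   spheres. *)
pose a := (ln K%:R + 1) / t.
have a0 : 0 <= a by rewrite divr_ge0; lra.
have [N hN] := dom (Num.sqrt a).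
have al g : a * (l g)%:R <= a * N%:R + displacement alpha 0 g.
  have d0 : 0 <= displacement alpha 0 g by exact: sqr_ge0.
  have [lN|Nl] := ltnP (l g) N.
    by rewrite ler_wpDr// ler_wpM2l// ler_nat ltnW.
  have [->|l0] := posnP (l g); first by rewrite mulr0 addr_ge0// mulr_ge0.
  have aN : 0 <= a * N%:R by rewrite mulr_ge0.
  have := hN g Nl; rewrite ler_pdivlMr ?sqrtr_gt0 ?ltr0n// => hg.
  rewrite ler_wpDl// /displacement subr0 -(sqr_sqrtr a0) -[(l g)%:R]sqr_sqrtr//.
  by rewrite -exprMn lerXn2r ?nnegrE ?mulr_ge0 ?sqrtr_ge0.
(* The offset [a * N], due to words shorter than [N], is absorbed in a constant factor. *)
apply: (@uniformly_summable_scale _ _ (expR (- (t * (a * N%:R))))).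
  exact: expR_gt0.
apply: (@uniformly_summable_levels _ l _ 1 K%:R (expR (- (t * a)))) => //.
- have -> : t * a = ln K%:R + 1 by rewrite /a; field; lra.
  rewrite -{1}(lnK K0') -expRD expR_lt1; lra.
- by move=> A k uA Ak; rewrite mul1r -natrX ler_nat hK.
- move=> g; rewrite -expRM_natl -expRD ler_expR.
  have := ler_wpM2l (ltW t0) (al g); lra.
Qed.

End Summability.

(** * From actions to the Liouville property *)

Lemma sum_fsbig (R : realType) (G : groupType) (mu F : G -> R) :
  finite_set [set g | mu g != 0] ->
  \sum_(g \in [set: G]) mu g * F g =
  \sum_(g <- fset_set [set g | mu g != 0]) mu g * F g.
Proof.
move=> fin; rewrite (fsbigE (fset_set [set g | mu g != 0])) ?fset_uniq//.
  by apply: eq_bigl => g; rewrite in_setT.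
move=> g _; rewrite in_fset_set// notin_setE /= => /negP; rewrite negbK => /eqP ->.
by rewrite mul0r.
Qed.

Lemma generates_ind (G : groupType) (S A : set G) : generates S ->
  A 1%g -> (forall g h, A g -> A h -> A (g / h)%g) -> S `<=` A -> forall g, A g.
Proof.
move=> gS A1 AD SA g.
have sA : group_closed (mem A).
  by split=> [|x y]; rewrite !inE//; exact: AD.
apply: (@smallest_sub _ (fun B : set G => group_closed (mem B)) S A sA SA g).
by have -> := gS.
Qed.

Lemma mu_liouville_of_action (R : realType) (G : groupType) (mu : G -> R) :
  adapted mu ->
  (forall c, 0 < c -> exists (H : hilbertType R) (alpha : G -> H -> H) (x : H)
    (t : R), [/\ affine_isometric_action alpha, 0 <= t,
      uniformly_summable (fun g => expR (- (t * displacement alpha 0 g)))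
    & t * \sum_(g \in [set: G]) mu g * displacement alpha x g <= c]) ->
  mu_liouville mu.
Proof.
move=> [mu0 fin sum1 sym gen] hyp f hf fb.
pose S : seq G := fset_set [set g | mu g != 0].
have memS g : (g \in S) = (mu g != 0).
  by rewrite in_fset_set//; apply/idP/idP; rewrite inE.
have sumS F : \sum_(g \in [set: G]) mu g * F g = \sum_(g <- S) mu g * F g.
  exact: sum_fsbig.
have mu_gt0 : {in S, forall s, 0 < mu s}.
  by move=> s; rewrite memS lt_def => ->; rewrite mu0.
have mu_sum1 : \sum_(s <- S) mu s = 1.
  rewrite -sum1; transitivity (\sum_(g \in [set: G]) mu g * 1).
    by rewrite sumS; apply: eq_bigr => g _; rewrite mulr1.
  by apply: eq_fsbigr => g _; rewrite mulr1.
have mu_sym F : \sum_(s <- S) mu s * F (s^-1)%g = \sum_(s <- S) mu s * F s.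
  rewrite [RHS](perm_big [seq (g^-1)%g | g <- S]).
    by rewrite big_map; apply: eq_bigr => s _; rewrite sym.
  apply: uniq_perm; first exact: fset_uniq.
    by rewrite map_inj_uniq ?fset_uniq//; exact: invg_inj.
  move=> g; rewrite -[g in RHS]invgK (mem_map (@invg_inj G)).
  by rewrite !memS sym.
have hH c : 0 < c -> exists C, forall k, walk_entropy S mu (2 ^ k) <= c * 2 ^+ k + C.
  move=> c0.
  (* Half of [c], because moving the base point from 0 to [x] costs a factor 2. *)
  have [H [alpha [x [t [aia t0 [Z Z0 hZ] tc]]]]] := hyp (c / 2) ltac:(lra).
  exists (t * (8 * `|x| ^+ 2) + ln Z) => k.
  apply: (le_trans (walk_entropy_le mu_gt0 mu_sum1 _ Z0 hZ)).
  rewrite addrA lerD2r walkZ//.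
  apply: (@le_trans _ _ (t * walk S mu (2 ^ k)
      (fun g => 2 * displacement alpha x g + 8 * `|x| ^+ 2))).
    by rewrite ler_wpM2l// walk_le// => g _; exact: displacement0_le.
  rewrite walk_linear walk_cst// mulrDr lerD2r.
  rewrite sumS in tc.
  have := ler_wpM2l t0 (walk_displacement_pow2 aia mu_gt0 mu_sum1 mu_sym x k).
  have k0 : 0 <= 2 ^+ k :> R by exact: exprn_ge0.
  have := ler_wpM2l k0 tc; lra.
have [B B0 fB] : exists2 B, 0 < B & forall g, `|f g| <= B.
  have [M [_ hM]] := fb; exists (`|M| + 1) => [|g].
    by rewrite ltr_wpDl.
  by apply: hM => //; rewrite (le_lt_trans (ler_norm _))// ltrDl.
have fS g s : s \in S -> f (g * s)%g = f g.
  (* Left translation preserves harmonicity; the normalization makes [f'] vanish at 1 and be bounded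
     by 1. *)
  move=> sS; pose f' y := (f (g * y)%g - f g) / (2 * B).
  suff : f' s = 0.
    move=> /eqP; rewrite mulf_eq0 invr_eq0 mulf_eq0 (gt_eqF B0) pnatr_eq0/= orbF.
    by rewrite subr_eq0 => /eqP.
  apply: (harmonic_eq0 mu_gt0 mu_sum1 hH) sS => [h||h].
  - rewrite /f' (hf (g * h)%g) sumS /average mulrBl mulr_suml.
    rewrite -[f g / _]mul1r -mu_sum1 mulr_suml -sumrB; apply: eq_bigr => s' _.
    by rewrite mulgA mulrBl mulrBr mulrA.
  - by rewrite /f' mulg1 subrr mul0r.
  - rewrite /f' normrM normfV (@ger0_norm _ (2 * B)); last lra.
    rewrite ler_pdivrMr ?mul1r; last lra.
    have := ler_normB (f (g * h)%g) (f g); have := fB (g * h)%g; have := fB g; lra.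
exists (f 1%g); apply/funext => g /=; rewrite -[g]mul1g.
(* The right periods of [f] form a subgroup containing the support of [mu]. *)
move: g 1%g; apply: (generates_ind (A := fun g => forall h, f (h * g)%g = f h) gen).
- by move=> h; rewrite mulg1.
- by move=> g h fg fh h'; rewrite mulgA -(fh (h' * g / h)%g) mulgVK fg.
- by move=> s /=; rewrite -memS => sS h; exact: fS.
Qed.

Theorem corollary10p4 (R : realType) (G : groupType)
  (fgG : finitely_generated G)
  (hG : (exists (H : hilbertType R) (alpha : G -> H -> H),
           affine_isometric_action alpha /\ poincare_exponent alpha = 0%E)
     \/ (exists (H : hilbertType R) (alpha : G -> H -> H),
           [/\ affine_isometric_action alpha, almost_fixed_points alpha
             & (poincare_exponent alpha < +oo)%E])
     \/ (exists (H : hilbertType R) (alpha : G -> H -> H) (l : G -> nat),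
           [/\ affine_isometric_action alpha, word_length_function l
             & dominates_sqrt alpha l])) :
  liouville R G.
Proof.
move=> mu adm; apply: (mu_liouville_of_action adm) => c c0.
have mu0 := adapted_ge0 adm; have fin := adapted_finite adm.
have small_t (H : hilbertType R) (alpha : G -> H -> H) :
    exists2 t, 0 < t &
      t * \sum_(g \in [set: G]) mu g * displacement alpha 0 g <= c.
  set d := \sum_(g \in _) _.
  have d0 : 0 <= d.
    by rewrite /d sum_fsbig// sumr_ge0// => g _; rewrite mulr_ge0// sqr_ge0.
  (* The [+ 1] covers the case [d = 0]. *)
  exists (c / (d + 1)); first by rewrite divr_gt0//; lra.
  rewrite mulrAC ler_pdivrMr; nra.
case: hG => [[H [alpha [aia e0]]]
           |[[H [alpha [aia afp efin]]]
            |[H [alpha [l [aia wl dom]]]]]].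
- have [t t0 tc] := small_t H alpha.
  exists H, alpha, 0, t; split => //; first exact: ltW.
  (* The exponent 0 lies below [t / 2], which lies below [t]. *)
  apply: (@summable_of_poincare_exponent _ _ _ _ (t / 2));
  rewrite ?e0 ?lte_fin; lra.
- have [t t0 et] : exists2 t, 0 < t & (poincare_exponent alpha < t%:E)%E.
    move: efin; case: (poincare_exponent alpha) => [r _|//|_].
      exists (`|r| + 1); rewrite ?ltr_wpDl// lte_fin.
      by rewrite (le_lt_trans (ler_norm _))// ltrDl.
    by exists 1 => //; exact: ltNyr.
  (* Here [t] cannot be small, so [x] is taken with squared displacement at most [q] on the support
     of [mu]; [2 * t] exceeds [t] strictly, as summability requires. *)
  have [q q0 qE] : exists2 q, 0 < q & q * (2 * t) = c.
    exists (c / (2 * t)); first by rewrite divr_gt0// mulr_gt0.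
    by rewrite divfK// mulf_neq0// gt_eqF.
  have [x hx] := afp [set g | mu g != 0] (Num.sqrt q) fin
    ltac:(by rewrite sqrtr_gt0).
  exists H, alpha, x, (2 * t); split => //; first lra.
    apply: (@summable_of_poincare_exponent _ _ _ _ t) => //; lra.
  rewrite mulrC -qE ler_pM2r; last lra.
  rewrite -[leRHS]mul1r -(adapted_sum1 adm).
  have -> : \sum_(g \in [set: G]) mu g = \sum_(g \in [set: G]) mu g * 1.
    by apply: eq_fsbigr => g _; rewrite mulr1.
  rewrite !sum_fsbig// mulr_suml big_seq [leRHS]big_seq; apply: ler_sum => g.
  rewrite in_fset_set// inE => /hx hg; rewrite mulr1 ler_wpM2l//.
  by rewrite -(sqr_sqrtr (ltW q0)) lerXn2r ?nnegrE ?sqrtr_ge0 ?normr_ge0.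
- have [t t0 tc] := small_t H alpha.
  exists H, alpha, 0, t; split => //; first exact: ltW.
  exact: summable_of_dominates_sqrt wl dom.
Qed.
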